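(* Let $K$ be an algebraically closed field of arbitrary characteristic, let $1\le d<n$, and let $w\in I_{d,n}$. Let $K[O^-]=K[x_{ij} : d+1\le i\le n,\ 1\le j\le d]$ be the coordinate ring of the opposite big cell $O^-$ of the Grassmannian $G_{d,n}$, equipped with the monomial order $\succ$ described in the context, and for $\theta\in I_{d,n}$ let $f_\theta\in K[O^-]$ be the restriction to $O^-$ of the Plücker coordinate $p_\theta$. Then the set $\{f_\theta : \theta\in I_{d,n},\ \theta\nleq w\}\subset K[O^-]$ forms a Gröbner basis (with respect to $\succ$) for the ideal it generates.
   Context: $I_{d,n}=\{(i_1,\dots,i_d): 1\le i_1<\dots<i_d\le n\}$ (identified with $W/W_{P_d}=S_n/(S_d\times S_{n-d})$), with the Bruhat order $\underline i\ge\underline j$ iff $i_t\ge j_t$ for all $1\le t\le d$. The opposite big cell $O^-\subset G_{d,n}$ is identified with the affine space of $n\times d$ matrices $\begin{pmatrix}\mathrm{Id}_{d\times d}\\ X\end{pmatrix}$, where $X=(x_{ij})$ is an arbitrary $(n-d)\times d$ matrix with rows indexed by $d+1\le i\le n$ and columns by $1\le j\le d$ (the matrix represents its column span). For $\theta=(\theta_1,\dots,\theta_d)\in I_{d,n}$, $f_\theta=p_\theta|_{O^-}$ is the determinant of the $d\times d$ submatrix of this $n\times d$ matrix with rows $\theta_1,\dots,\theta_d$; up to sign it is a minor of $X$ (equal to $1$ if $\theta=(1,\dots,d)$). Monomial order $\succ$: order the variables by $x_{ij}>x_{i'j'}$ if $i>i'$, or if $i=i'$ and $j<j'$. Write each monomial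 as a product of variables in weakly decreasing order. Then $y_1\cdots y_r\succ z_1\cdots z_s$ (variables $y_1\ge\dots\ge y_r$, $z_1\ge\dots\ge z_s$) iff either $r>s$, or $r=s$ and there is $l<r$ with $y_1=z_1,\dots,y_l=z_l$, $y_{l+1}>z_{l+1}$. The initial term $\mathrm{in}(f)$ of a polynomial $f$ is the largest monomial present in $f$; $\mathrm{in}(I)$ is the ideal generated by initial terms of the elements of an ideal $I$; a finite set $\mathcal G\subset I$ is a Gröbner basis of $I$ if $\mathrm{in}(I)$ is generated by the initial terms of the elements of $\mathcal G$. *)

(* Defs.v *)
From HB Require Import structures.
From mathcomp Require Import all_boot all_order all_algebra.
From mathcomp Require Import mpoly.

Set Implicit Arguments.
Unset Strict Implicit.
Unset Printing Implicit Defensive.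

Import GRing.Theory.
Local Open Scope ring_scope.

(* All indices are 0-based: the indices 1, ..., n of the usual notation are
   the elements 0, ..., n-1 of 'I_n, so the row condition d+1 <= i becomes
   d <= i. *)

Definition Idn (d n : nat) :=
  {t : d.-tuple 'I_n | sorted ltn [seq val i | i <- t]}.

Definition bruhat_le (d n : nat) (a b : Idn d n) : bool :=
  [forall t : 'I_d, (tnth (val a) t <= tnth (val b) t)%N].

(* The pair (i, j) stands for the variable x_ij. *)
Definition cell_var (d n : nat) := ({i : 'I_n | (d <= i)%N} * 'I_d)%type.

(* {mpoly K[N]} has its variables indexed by 'I_N; cell variables are passed
   to and from 'I_N by enum_rank and enum_val. *)
Notation nb_var d n := #|{: cell_var d n}|.
Notation cell_ring K d n := {mpoly K[nb_var d n]}.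
Notation cell_mon d n := 'X_{1..nb_var d n}.

Definition cell_mx (K : fieldType) (d n : nat) :
    'M[cell_ring K d n]_(n, d) :=
  \matrix_(i < n, j < d)
    if insub i is Some i' then 'X_(enum_rank ((i', j) : cell_var d n))
    else ((i : nat) == j)%:R.

Definition pluecker (K : fieldType) (d n : nat) (theta : Idn d n) :
    cell_ring K d n :=
  \det (rowsub (tnth (val theta)) (cell_mx K d n)).

Definition var_gt (d n : nat) (x y : cell_var d n) : bool :=
  (val y.1 < val x.1)%N || ((x.1 == y.1) && (x.2 < y.2)%N).

Definition var_ge (d n : nat) (x y : cell_var d n) : bool :=
  (x == y) || var_gt x y.

(* The variables of m, with multiplicity, in weakly decreasing order. *)
Definition mon_word (d n : nat) (m : cell_mon d n) : seq (cell_var d n) :=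
  sort (@var_ge d n)
    (flatten [seq nseq (m (enum_rank x)) x | x <- enum {: cell_var d n}]).

Definition mon_gt (d n : nat) (m m' : cell_mon d n) : Prop :=
  let y := mon_word m in
  let z := mon_word m' in
  (size z < size y)%N \/
  size y = size z /\
    exists (s t t' : seq (cell_var d n)) (u v : cell_var d n),
      [/\ y = s ++ u :: t, z = s ++ v :: t' & var_gt u v].

(* The initial term carries no coefficient; 0 has no initial term. *)
Definition initial_term (K : fieldType) (d n : nat)
    (f g : cell_ring K d n) : Prop :=
  exists m : cell_mon d n,
    [/\ g = 'X_[m], m \in msupp f
      & forall m', m' \in msupp f -> m' != m -> mon_gt m m'].

Definition ideal_gen (A : comNzRingType) (S : A -> Prop) (f : A) : Prop :=
  exists s : seq (A * A),
    (forall p, p \in s -> S p.2) /\ f = \sum_(p <- s) p.1 * p.2.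

Definition initial_ideal (K : fieldType) (d n : nat)
    (P : cell_ring K d n -> Prop) : cell_ring K d n -> Prop :=
  ideal_gen (fun g => exists f, P f /\ initial_term f g).

(* I is meant to be an ideal; the finite set G is given by a list. *)
Definition groebner_basis (K : fieldType) (d n : nat)
    (G : seq (cell_ring K d n)) (I : cell_ring K d n -> Prop) : Prop :=
  (forall g, g \in G -> I g) /\
  (forall f, initial_ideal I f <-> initial_ideal (fun g => g \in G) f).

(* Main.v *)
Require Import Defs.
From HB Require Import structures.
From mathcomp Require Import all_boot all_order all_algebra.
From mathcomp Require Import fingroup perm mpoly.
From mathcomp Require Import ring zify.

(** Turn the matrix X upside down, so that its last row becomes the first one
    and the initial term of a minor is the product of its main diagonal.  If
    theta is not below w, then for some t at least d - t entries of theta exceed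
    w_t; so f_theta vanishes wherever, for each t, the rows after w_t of the full
    n x d matrix have rank less than d - t.  In terms of X this is a condition of
    the form: the a x b north-west corner has rank less than s.  The pairs (a, b)
    coming from w form a staircase: as t grows, a decreases and b increases
    weakly.

    The core is [chain_free_vanishing_eq0], where no monomial order occurs: if f
    vanishes at all matrices that satisfy a staircase of rank conditions, and no
    monomial of f contains a chain of s cells going strictly down and right
    inside an a x b corner whose rank must be less than s, then f = 0.  Take the
    condition (a, b, s) with a + b maximal and let x be the entry in the cell
    that it has at its south-east end, so that no other condition involves x.
    Split the matrix along that cell, M being the part strictly north-west of x,
    u the part of the column of x above it and v the part of its row to its left.
    Consider a matrix that satisfies the conditions other than (a, b, s).
     - If rank M < s - 1, replace M by M + t u v and x by 1 / t.  Now all conditions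
       hold: the corner (a, b) has rank at most rank M + 1, and every other
       corner is only changed by column or row operations, because the conditions
       form a staircase.  Letting t tend to 0, the coefficient of the highest
       power of x in f vanishes at all matrices with rank M < s - 1 that satisfy
       the other conditions; those form a smaller staircase, and a chain of
       s - 1 cells for M extends by x.  Hence, by induction, x does not occur
       in f.
     - If rank M = s - 1, and the corners (a - 1, b) and (a, b - 1) have rank
       less than s, then some value of x gives the corner (a, b) rank less than s.
       So f, in which x does not occur, vanishes under the conditions where
       (a, b, s) is replaced by (a - 1, b, s) and (a, b - 1, s); again a smaller
       staircase.

    Every chain of s cells in a corner coming from w divides the initial term of
    some f_theta with theta not below w ([chain_reducible]), and every f_theta
    with theta not below w vanishes under the rank conditions of w
    ([pluecker_vanishes]).  Therefore an element of the ideal none of whose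
    monomials is divisible by one of these initial terms is 0, and by division
    with remainder this is the property of being a Groebner basis
    ([groebner_basis_standard_independent]). *)

Set Implicit Arguments.
Unset Strict Implicit.
Unset Printing Implicit Defensive.

Import GRing.Theory.
Local Open Scope ring_scope.

(** * Ranks of north-west corners *)

Section CornerRank.
Variable K : fieldType.
Implicit Types (Y : nat -> nat -> K) (a b : nat).

Definition corner Y a b : 'M[K]_(a, b) := \matrix_(i, j) Y i j.

Definition set_entry Y a b (x : K) : nat -> nat -> K :=
  fun i j => if (i == a) && (j == b) then x else Y i j.

(** With M the part of Y strictly north-west of the cell (a, b), u the column
    above that cell and v the row to its left, this is the curve M + t u v, 1 / t,
    whose other entries stay fixed.  It has a pole at t = 0 in the entry (a, b)
    only. *)
Definition blow_up Y a b (t : K) : nat -> nat -> K :=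
  fun i j =>
    if (i == a) && (j == b) then t^-1
    else if (i < a)%N && (j < b)%N then Y i j + t * Y i b * Y a j
    else Y i j.

Lemma corner_set_entry Y a b x a1 b1 :
  (a1 <= a)%N || (b1 <= b)%N ->
  corner (set_entry Y a b x) a1 b1 = corner Y a1 b1.
Proof.
move=> h; apply/matrixP=> i j; rewrite !mxE /set_entry; case: eqP => //= ia.
by case: eqP => //= jb; have := ltn_ord i; have := ltn_ord j; lia.
Qed.

(** By hypothesis the last row of the bigger corner is a combination of the rows
    of the smaller one.  The same combination, taken in column b, gives the entry. *)
Lemma corner_completion Y a b :
  (\rank (corner Y a.+1 b) <= \rank (corner Y a b))%N ->
  exists x, (\rank (corner (set_entry Y a b x) a.+1 b.+1)
             <= \rank (corner Y a b.+1))%N.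
Proof.
move=> h.
have sub : (corner Y a b <= corner Y a.+1 b)%MS.
  apply/row_subP => i; apply: (eq_row_sub (widen_ord (leqnSn a) i)).
  by apply/rowP=> j; rewrite !mxE.
have /submxP[u hu] : (row ord_max (corner Y a.+1 b) <= corner Y a b)%MS.
  apply: (submx_trans (row_sub _ _)).
  by have := mxrank_leqif_sup sub; move=> /geq_leqif <-.
exists (\sum_(i < a) u 0 i * Y i b); apply: mxrankS.
apply/row_subP => i; have [ia|ia] := ltnP i a.
  apply: (eq_row_sub (Ordinal ia)); apply/rowP=> j; rewrite !mxE /set_entry.
  by rewrite /= (ltn_eqF ia).
have {ia} ia : i = a :> nat by have := ltn_ord i; lia.
apply/submxP; exists u; apply/rowP=> j; rewrite !mxE /set_entry ia eqxx /=.
case: eqP => [jb|jb]; first by apply: eq_bigr => k _; rewrite !mxE jb.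
have jlt : (j < b)%N by have := ltn_ord j; lia.
have /rowP/(_ (Ordinal jlt)) := hu; rewrite !mxE /= => ->.
by apply: eq_bigr => k _; rewrite !mxE.
Qed.

(** The blown up corner is the sum of M, bordered by zeros, and of the rank one
    matrix t^-1 (t u, 1)^T (t v, 1). *)
Lemma rank_blow_up_corner Y a b t : t != 0 ->
  (\rank (corner (blow_up Y a b t) a.+1 b.+1) <= (\rank (corner Y a b)).+1)%N.
Proof.
move=> t0.
pose P : 'M[K]_(a.+1, a) := \matrix_(i, k) ((i == k :> nat))%:R.
pose Q : 'M[K]_(b, b.+1) := \matrix_(k, j) ((k == j :> nat))%:R.
pose u : 'M[K]_(a.+1, 1) := \matrix_(i, k) (if (i < a)%N then Y i b else t^-1).
pose v : 'M[K]_(1, b.+1) := \matrix_(k, j) (if (j < b)%N then t * Y a j else 1).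
(* P and Q border M by a zero row and a zero column. *)
have PMQ i j : (P *m corner Y a b *m Q) i j =
    if (i < a)%N && (j < b)%N then Y i j else 0.
  rewrite mxE; have [jb|jb] := ltnP j b; last first.
    rewrite andbF big1 // => k _; rewrite [Q _ _]mxE.
    by case: eqP => [E|_]; rewrite ?mulr0 //; have := ltn_ord k; lia.
  rewrite (bigD1 (Ordinal jb)) //= [Q _ _]mxE eqxx mulr1 big1 ?addr0; last first.
    move=> k; rewrite [Q _ _]mxE -val_eqE /= => /negbTE ->; by rewrite mulr0.
  rewrite mxE andbT; have [ia|ia] := ltnP i a; last first.
    rewrite big1 // => k _; rewrite mxE.
    by case: eqP => [E|_]; rewrite ?mul0r //; have := ltn_ord k; lia.
  rewrite (bigD1 (Ordinal ia)) //= !mxE eqxx mul1r big1 ?addr0 // => k.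
  by rewrite mxE -val_eqE eq_sym /= => /negbTE ->; rewrite mul0r.
have -> : corner (blow_up Y a b t) a.+1 b.+1 = P *m corner Y a b *m Q + u *m v.
  apply/matrixP=> i j; rewrite [RHS]mxE PMQ !mxE big_ord1 !mxE /blow_up.
  have := leq_ord i; have := leq_ord j; move: (val i) (val j) => {}i {}j.
  rewrite leq_eqVlt => /predU1P[->|jb]; rewrite leq_eqVlt => /predU1P[->|ia].
  - by rewrite !eqxx !ltnn add0r mulr1.
  - by rewrite ia (ltn_eqF ia) !ltnn /= add0r mulr1.
  - by rewrite jb (ltn_eqF jb) eqxx !ltnn /= add0r mulrA mulVf // mul1r.
  - by rewrite ia jb (ltn_eqF ia) /=; ring.
rewrite -[X in (_ <= X)%N]addn1; apply: leq_trans (mxrank_add _ _) (leq_add _ _).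
  exact: leq_trans (mxrankM_maxl _ _) (mxrankM_maxr _ _).
exact: leq_trans (mxrankM_maxl _ _) (rank_leq_col _).
Qed.

(** When the corner contains column b but not row a, the curve adds multiples of
    column b to the columns on its left. *)
Lemma rank_blow_up_wide Y a b t a1 b1 : (a1 <= a)%N -> (b < b1)%N ->
  (\rank (corner (blow_up Y a b t) a1 b1) <= \rank (corner Y a1 b1))%N.
Proof.
move=> ha hb.
pose Q : 'M[K]_b1 := \matrix_(k, j) ((k == j)%:R +
  (k == b :> nat)%:R * (if (j < b)%N then t * Y a j else 0)).
suff -> : corner (blow_up Y a b t) a1 b1 = corner Y a1 b1 *m Q.
  exact: mxrankM_maxl.
apply/matrixP=> i j; have ia := leq_trans (ltn_ord i) ha.
rewrite !mxE /blow_up (ltn_eqF ia) ia /=.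
under eq_bigr => k _ do rewrite !mxE mulrDr.
rewrite big_split /= (bigD1 j) //= eqxx mulr1 big1 ?addr0; last first.
  by move=> k /negbTE ->; rewrite mulr0.
rewrite (bigD1 (Ordinal hb)) //= eqxx mul1r big1 ?addr0; last first.
  by move=> k; rewrite -val_eqE /= => /negbTE ->; rewrite mul0r mulr0.
by case: ifP => _; rewrite ?mulr0 ?addr0 //; ring.
Qed.

Lemma tr_corner Y a b : (corner Y a b)^T = corner (fun i j => Y j i) b a.
Proof. by apply/matrixP=> i j; rewrite !mxE. Qed.

Lemma rank_blow_up_tall Y a b t a1 b1 : (a < a1)%N -> (b1 <= b)%N ->
  (\rank (corner (blow_up Y a b t) a1 b1) <= \rank (corner Y a1 b1))%N.
Proof.
move=> ha hb; rewrite -mxrank_tr -[X in (_ <= X)%N]mxrank_tr !tr_corner.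
have -> : corner (fun i j => blow_up Y a b t j i) b1 a1 =
          corner (blow_up (fun i j => Y j i) b a t) b1 a1.
  apply/matrixP=> i j; rewrite !mxE /blow_up andbC [X in if X then _ + _ else _]andbC.
  by rewrite [t * Y j b * _]mulrAC.
exact: rank_blow_up_wide.
Qed.

End CornerRank.

(** * Evaluation of polynomials over an infinite field *)

Section Slices.
Variables (N : nat) (K : fieldType).
Implicit Types (f : {mpoly K[N]}) (m : 'X_{1..N}) (v : 'I_N -> K).

(** Slices keep the monomials unchanged instead of dividing out a power of a
    variable, so that their coefficients are still coefficients of f. *)
Definition slice f (P : pred 'X_{1..N}) : {mpoly K[N]} :=
  \sum_(m <- msupp f | P m) f@_m *: 'X_[m].

Lemma mcoeff_slice f P m : (slice f P)@_m = if P m then f@_m else 0.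
Proof.
rewrite /slice raddf_sum /=.
under eq_bigr => k _ do rewrite mcoeffZ mcoeffX.
have [mf|mf] := boolP (m \in msupp f); last first.
  rewrite (memN_msupp_eq0 mf) if_same big1_seq // => k /andP[_ kf].
  by case: eqP => [E|_]; rewrite ?mulr0 // -E kf in mf *.
rewrite big_mkcond (bigD1_seq m) ?msupp_uniq //= eqxx mulr1 big1 ?addr0 //.
by move=> k /negbTE ->; rewrite mulr0 if_same.
Qed.

Lemma msupp_slice f P m : m \in msupp (slice f P) -> P m && (m \in msupp f).
Proof. by rewrite !mcoeff_msupp mcoeff_slice; case: ifP; rewrite ?eqxx. Qed.

Lemma meval_slice f P v :
  (slice f P).@[v] = \sum_(m <- msupp f | P m) f@_m * \prod_i v i ^+ m i.
Proof.
rewrite /slice raddf_sum /=; apply: eq_bigr => m _.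
by rewrite mevalZ mevalX.
Qed.

Hypothesis K_infinite : forall p : {poly K}, p != 0 -> exists x, ~~ root p x.

Lemma poly_eq0_on_nonzero (p : {poly K}) :
  (forall t, t != 0 -> p.[t] = 0) -> p = 0.
Proof.
move=> h; apply/eqP; apply/negP => /negP p0.
have /K_infinite[t] : 'X * p != 0 by rewrite mulf_neq0 ?polyX_eq0.
rewrite rootE hornerM hornerX; have [->|/h ->] := eqVneq t 0.
  by rewrite mul0r eqxx.
by rewrite mulr0 eqxx.
Qed.

(** Scaling the i-th coordinate by t turns the values of f into a polynomial in t
    whose coefficients are the values of the slices. *)
Lemma meval_degree_slice f (i : 'I_N) e :
  (forall v, f.@[v] = 0) -> forall v, (slice f (fun m => m i == e)).@[v] = 0.
Proof.
move=> f0 v.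
pose p : {poly K} := \sum_(m <- msupp f) (f@_m * \prod_j v j ^+ m j) *: 'X^(m i).
have p0 : p = 0.
  apply: poly_eq0_on_nonzero => t _; rewrite /p horner_sum.
  rewrite -[RHS](f0 (fun j => (if j == i then t else 1) * v j)) mevalE.
  apply: eq_bigr => m _; rewrite hornerZ hornerXn -mulrA; congr (_ * _).
  under [RHS]eq_bigr => j _ do rewrite exprMn.
  rewrite big_split /= mulrC; congr (_ * _).
  rewrite (bigD1 i) //= eqxx big1 ?mulr1 // => j /negbTE ->.
  by rewrite expr1n.
have p0e : p`_e = 0 by rewrite p0 coef0.
rewrite -[RHS]p0e.
rewrite meval_slice /p coef_sum big_mkcond /=; apply: eq_bigr => m _.
by rewrite coefZ coefXn eq_sym; case: ifP; rewrite ?mulr1 ?mulr0.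
Qed.

(** Prescribing the exponents of one variable after the other isolates a single
    monomial of f. *)
Lemma mpoly_eq0_on_points f : (forall v, f.@[v] = 0) -> f = 0.
Proof.
move=> f0; apply/mpolyP => m; rewrite mcoeff0.
have slice0 (s : seq 'I_N) v :
    (slice f (fun m' => all (fun i => m' i == m i) s)).@[v] = 0.
  elim: s v => [|i s IH] v.
    by rewrite (_ : slice _ _ = f) //; apply/mpolyP => m'; rewrite mcoeff_slice.
  rewrite -[RHS](meval_degree_slice i (m i) IH v); congr (_.@[_]).
  apply/mpolyP => m'; rewrite !mcoeff_slice /=.
  by case: (m' i == m i); case: all.
have := slice0 (enum 'I_N) (fun=> 1); rewrite (_ : slice _ _ = f@_m *: 'X_[m]).
  rewrite mevalZ mevalX big1 ?mulr1 // => i _; exact: expr1n.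
apply/mpolyP => m'; rewrite mcoeff_slice mcoeffZ mcoeffX.
case: allP => [h|h].
  suff -> : m' = m by rewrite eqxx mulr1.
  by apply/mnmP => i; apply/eqP/h; rewrite mem_enum.
by case: eqP => [E|_]; rewrite ?mulr0 //; case: h => i _; rewrite E.
Qed.

End Slices.

(** * Staircases of rank conditions *)

Section RankLocus.
Variables (N : nat) (K : fieldType) (pos : 'I_N -> nat * nat).
Hypothesis pos_inj : injective pos.
Hypothesis K_infinite : forall p : {poly K}, p != 0 -> exists x, ~~ root p x.
Implicit Types (f : {mpoly K[N]}) (m : 'X_{1..N}) (Y : nat -> nat -> K).
Implicit Types (L : seq (nat * nat * nat)).

(** A matrix is a function on all pairs of naturals, of which only the entries
    at the cells of the variables matter; corners of any size then make sense. *)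
Definition cell_values Y : 'I_N -> K := fun k => Y (pos k).1 (pos k).2.

(** Along the curve, t ^+ e times the value of f is a polynomial in t.  It vanishes
    for all t != 0, hence also at 0, where only the monomials of the highest
    degree e in x remain. *)
Lemma meval_blow_up f Y (x : 'I_N) a b e :
  pos x = (a, b) -> (forall m, m \in msupp f -> (m x <= e)%N) ->
  (forall t, t != 0 -> f.@[cell_values (blow_up Y a b t)] = 0) ->
  (slice f (fun m => m x == e)).@[cell_values Y] = 0.
Proof.
move=> px le_e f0.
pose u k : {poly K} := (cell_values Y k)%:P +
  (if ((pos k).1 < a)%N && ((pos k).2 < b)%N
   then Y (pos k).1 b * Y a (pos k).2 else 0) *: 'X.
pose p : {poly K} := \sum_(m <- msupp f)
  f@_m *: ('X^(e - m x) * \prod_(k | k != x) u k ^+ m k).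
have p0 : p = 0.
  apply: poly_eq0_on_nonzero => // t t0; rewrite /p horner_sum.
  transitivity (t ^+ e * f.@[cell_values (blow_up Y a b t)]); last first.
    by rewrite f0 ?mulr0.
  rewrite mevalE mulr_sumr.
  rewrite [LHS]big_seq [RHS]big_seq; apply: eq_bigr => m /le_e me.
  rewrite hornerZ hornerM hornerXn horner_prod [RHS]mulrCA; congr (_ * _).
  rewrite [in RHS](bigD1 x) //= mulrA; congr (_ * _).
    rewrite /cell_values px /blow_up !eqxx /= exprVn.
    by rewrite -[in RHS](subnK me) exprD mulfK // expf_neq0.
  apply: eq_bigr => k kx.
  have /negbTE off : ~~ (((pos k).1 == a) && ((pos k).2 == b)).
    by rewrite -xpair_eqE -surjective_pairing -px (inj_eq pos_inj).
  rewrite horner_exp /u !hornerE /cell_values /blow_up off.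
  by case: ifP => _; rewrite ?mul0r ?addr0 //; congr (_ ^+ _); ring.
transitivity (cell_values Y x ^+ e * p.[0]); last by rewrite p0 horner0 mulr0.
rewrite meval_slice horner_sum mulr_sumr big_mkcond.
rewrite [LHS]big_seq [RHS]big_seq; apply: eq_bigr => m /le_e me.
rewrite hornerZ hornerM hornerXn horner_prod.
case: eqP => [E|E]; last first.
  rewrite (_ : 0 ^+ _ = 0) ?(mul0r, mulr0) //.
  by apply/eqP; rewrite expf_eq0 eqxx andbT; lia.
rewrite E subnn expr0 mul1r [RHS]mulrCA; congr (_ * _).
rewrite (bigD1 x) //= E; congr (_ * _); apply: eq_bigr => k _.
by rewrite horner_exp /u !hornerE ?mulr0 ?addr0.
Qed.

Definition in_corner (a b : nat) (c : nat * nat) := (c.1 < a)%N && (c.2 < b)%N.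

Definition cell_lt (c c' : nat * nat) := (c.1 < c'.1)%N && (c.2 < c'.2)%N.

(** These are the monomials divisible by the main diagonal of some s-minor of the
    a x b corner. *)
Definition supports_chain m (a b s : nat) : Prop :=
  exists c : seq 'I_N,
    [/\ size c = s, sorted cell_lt (map pos c),
        all (fun k => in_corner a b (pos k)) c & all (fun k => 0 < m k)%N c].

Definition chain_free L f : Prop :=
  forall m, m \in msupp f -> forall a b s, (a, b, s) \in L ->
    ~ supports_chain m a b s.

Definition rank_locus L Y : Prop :=
  forall a b s, (a, b, s) \in L -> (\rank (corner Y a b) < s)%N.

(** As the condition is required of both orders of a pair, no corner of the list
    is strictly smaller than another one in both directions. *)
Definition staircase L : Prop :=
  forall a b s a1 b1 s1, (a, b, s) \in L -> (a1, b1, s1) \in L ->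
    (a <= a1)%N || (b <= b1)%N.

Definition covered L : Prop :=
  forall a b s, (a, b, s) \in L -> forall i j, (i < a)%N -> (j < b)%N ->
    exists k, pos k = (i, j).

(** Replacing a corner (a, b) by two corners with smaller sum a + b decreases this
    weight. *)
Definition weight L := (\sum_(c <- L) 3 ^ (c.1.1 + c.1.2))%N.

Lemma supports_chainS m a b s a1 b1 : (a <= a1)%N -> (b <= b1)%N ->
  supports_chain m a b s -> supports_chain m a1 b1 s.
Proof.
move=> ha hb [c [sc lc ic pc]]; exists c; split=> //.
apply: sub_all ic => k /andP[h1 h2]; apply/andP; split.
  exact: leq_trans h1 ha.
exact: leq_trans h2 hb.
Qed.

Lemma supports_chain_rcons m a b s x : pos x = (a, b) -> (0 < m x)%N ->
  supports_chain m a b s -> supports_chain m a.+1 b.+1 s.+1.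
Proof.
move=> px mx [c [sc lc ic pc]]; exists (rcons c x); split.
- by rewrite size_rcons sc.
- rewrite map_rcons; case: c lc ic {sc pc} => //= y c lc ic.
  rewrite rcons_path lc /= last_map px.
  by move/allP: (ic : all _ (y :: c)); apply; rewrite mem_last.
- rewrite all_rcons px /in_corner !ltnSn /=.
  by apply: sub_all ic => k /andP[h1 h2]; rewrite /in_corner !ltnS (ltnW h1) (ltnW h2).
- by rewrite all_rcons mx.
Qed.

End RankLocus.

(** Used for a least element among conditions, and for a monomial of highest
    degree in a variable. *)
Lemma seq_least (T : eqType) (r : rel T) (s : seq T) :
  total r -> transitive r -> s != [::] ->
  exists2 x, x \in s & forall y, y \in s -> r x y.
Proof.
move=> r_tot r_tr; elim: s => // x s IH _.
have rr y : r y y by have := r_tot y y; rewrite orbb.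
have [->|/IH[y ys yP]] := eqVneq s [::].
  by exists x; rewrite ?mem_head // => y; rewrite inE => /eqP ->.
have /orP[xy|yx] := r_tot x y; [exists x | exists y].
- exact: mem_head.
- move=> z; rewrite inE => /predU1P[->//|/yP]; exact: r_tr.
- by rewrite inE ys orbT.
- by move=> z; rewrite inE => /predU1P[->//|/yP].
Qed.

Section Vanishing.
Variables (N : nat) (K : fieldType) (pos : 'I_N -> nat * nat).
Hypothesis pos_inj : injective pos.
Hypothesis K_infinite : forall p : {poly K}, p != 0 -> exists x, ~~ root p x.
Implicit Types (f : {mpoly K[N]}) (Y : nat -> nat -> K).
Implicit Types (L : seq (nat * nat * nat)).

Lemma cell_values_surj (v : 'I_N -> K) : exists Y, cell_values pos Y =1 v.
Proof.
exists (fun i j => if [pick k | pos k == (i, j)] is Some k then v k else 0).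
move=> k; rewrite /cell_values; case: pickP => [l|/(_ k)].
  by rewrite -surjective_pairing => /eqP/pos_inj ->.
by rewrite -surjective_pairing eqxx.
Qed.

(** The induction takes away the south-east cell of an outermost corner.  It may
    lower s from 1 to 0: then no matrix satisfies the conditions, but the empty
    chain leaves no monomial for f either. *)
Theorem chain_free_vanishing_eq0 L f :
  staircase L -> covered pos L -> chain_free pos L f ->
  (forall Y, rank_locus L Y -> f.@[cell_values pos Y] = 0) -> f = 0.
Proof.
have [k] := ubnP (weight L); elim: k => // k IH in L f *.
rewrite ltnS => wk st co cf f0.
have [L0|L0] := eqVneq L [::].
  apply: mpoly_eq0_on_points => // v; have [Y Yv] := cell_values_surj v.
  by rewrite -(meval_eq f Yv) f0 // L0 => a b s.
(* Outermost first; among conditions on the same corner, the strongest first. *)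
pose r (c c' : nat * nat * nat) := (c'.1.1 + c'.1.2 < c.1.1 + c.1.2)%N ||
  (c'.1.1 + c'.1.2 == c.1.1 + c.1.2)%N && (c.2 <= c'.2)%N.
have [] := @seq_least _ r L _ _ L0; rewrite /r; first by move=> c c'; lia.
  by move=> c c1 c2; lia.
move=> [[a b] s] abs_L; rewrite /= => maxL.
pose others := [seq c <- L | c.1 != (a, b)].
have mem_others a1 b1 s1 : (a1, b1, s1) \in others ->
    (a1, b1, s1) \in L /\ (a1, b1) != (a, b).
  by rewrite mem_filter => /andP[].
have w_others : (3 ^ (a + b) + weight others <= weight L)%N.
  rewrite /weight big_filter [X in (_ <= X)%N](bigID (fun c => c.1 == (a, b))) /=.
  by rewrite leq_add2r (big_rem _ abs_L) /= eqxx leq_addr.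
have st_others : staircase others.
  by move=> ? ? ? ? ? ? /mem_others[h1 _] /mem_others[h2 _]; apply: st h1 h2.
have co_others : covered pos others.
  by move=> ? ? ? /mem_others[h _]; apply: co h.
have cf_others : chain_free pos others f.
  by move=> ? mf ? ? ? /mem_others[h _]; apply: cf mf _ _ _ h.
have bound s1 : (a, b, s1) \in L -> (s <= s1)%N.
  by move/maxL; rewrite /= ltnn eqxx.
case: s => [|s] in abs_L bound maxL *.
  apply/mpolyP => m; rewrite mcoeff0; apply: memN_msupp_eq0; apply/negP => mf.
  by apply: (cf m mf a b 0%N abs_L); exists [::].
have [ab0|] := boolP ((a == 0%N) || (b == 0%N)).
  apply: (IH others) => //; first by have := expn_gt0 3 (a + b); lia.
  move=> Y Yo; apply: f0 => a1 b1 s1 h1.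
  have [E|ne] := eqVneq (a1, b1) (a, b); last by apply: Yo; rewrite mem_filter ne.
  case: E => ? ?; subst a1 b1; apply: leq_trans (bound _ h1); rewrite ltnS.
  by case/orP: ab0 => /eqP ->; rewrite ?thinmx0 ?flatmx0 mxrank0.
case: a b => [|a] [|b] // in abs_L bound maxL others mem_others w_others
  st_others co_others cf_others *.
move=> _.
have [x px] := co _ _ _ abs_L _ _ (ltnSn a) (ltnSn b).
(* Each other corner misses the row a or the column b, but not both. *)
have far a1 b1 s1 : (a1, b1, s1) \in others ->
    (a1 <= a)%N && (b < b1)%N || (a < a1)%N && (b1 <= b)%N.
  case/mem_others => h; rewrite xpair_eqE => ne.
  have := st _ _ _ _ _ _ abs_L h; have := st _ _ _ _ _ _ h abs_L.
  have := maxL _ h; rewrite /=; lia.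
(* LC controls the leading coefficient in x, LN the polynomials free of x. *)
pose LC := (a, b, s) :: others.
pose LN := (a, b.+1, s.+1) :: (a.+1, b, s.+1) :: others.
have [->//|fn0] := eqVneq f 0.
have [] := @seq_least _ (fun m m' : 'X_{1..N} => m' x <= m x)%N (msupp f).
- by move=> m m'; exact: leq_total.
- by move=> m m' m'' h1 h2; exact: leq_trans h2 h1.
- by rewrite msupp_eq0.
move=> m0 m0f max_m0; set e := m0 x in max_m0.
have slice0 Y : rank_locus LC Y ->
    (slice f (fun m => m x == e)).@[cell_values pos Y] = 0.
  move=> YC; apply: (meval_blow_up pos_inj _ px) => // t t0.
  apply: f0 => a1 b1 s1 h1.
  have [E|ne] := eqVneq (a1, b1) (a.+1, b.+1).
    case: E => ? ?; subst a1 b1; apply: leq_trans (bound _ h1); rewrite ltnS.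
    apply: leq_trans (rank_blow_up_corner Y a b t0) _.
    by apply: YC; rewrite mem_head.
  have h2 : (a1, b1, s1) \in others by rewrite mem_filter ne.
  have rY : (\rank (corner Y a1 b1) < s1)%N by apply: YC; rewrite inE h2 orbT.
  by case/orP: (far _ _ _ h2) => /andP[i1 i2]; apply: leq_ltn_trans rY;
    [apply: rank_blow_up_wide | apply: rank_blow_up_tall].
have w_pos : (3 ^ (a + b) < 3 ^ (a.+1 + b.+1))%N by rewrite ltn_exp2l //; lia.
(* Otherwise the slice of highest degree e would be 0 by the case of LC. *)
have e0 : e = 0%N.
  apply/eqP; apply: contraTT m0f => e_pos; rewrite mcoeff_msupp negbK.
  suff h : slice f (fun m => m x == e) = 0.
    by have := mcoeff_slice f (fun m => m x == e) m0; rewrite h eqxx mcoeff0 => ->.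
  apply: (IH LC) => //.
  - rewrite /LC /weight big_cons -/(weight _) /=; lia.
  - move=> a1 b1 s1 a2 b2 s2; rewrite !inE.
    case/predU1P => [[-> -> _]|h1]; case/predU1P => [[-> -> _]|h2].
    + by rewrite leqnn.
    + by have := far _ _ _ h2; lia.
    + by have := far _ _ _ h1; lia.
    + exact: st_others h1 h2.
  - move=> a1 b1 s1; rewrite inE => /predU1P[[-> -> _]|h]; last exact: co_others h.
    by move=> i j ia jb; apply: (co _ _ _ abs_L); apply: ltnW.
  - move=> m /msupp_slice/andP[/eqP mx mf] a1 b1 s1; rewrite inE.
    case/predU1P => [[-> -> ->]|h]; last exact: cf_others mf _ _ _ h.
    move/(supports_chain_rcons px); rewrite mx lt0n e_pos => /(_ isT).
    exact: cf mf _ _ _ abs_L.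
have mx0 m : m \in msupp f -> m x = 0%N.
  by move=> /max_m0; rewrite e0 leqn0 => /eqP.
have f_free Y z :
    f.@[cell_values pos (set_entry Y a b z)] = f.@[cell_values pos Y].
  rewrite !mevalE [LHS]big_seq [RHS]big_seq; apply: eq_bigr => m /mx0 mx.
  congr (_ * _); apply: eq_bigr => l _; have [->|lx] := eqVneq l x.
    by rewrite mx.
  rewrite /cell_values /set_entry -xpair_eqE -surjective_pairing -px.
  by rewrite (inj_eq pos_inj) (negbTE lx).
apply: (IH LN) => //.
- rewrite /LN /weight !big_cons -/(weight _) /= addnS addSn.
  have := expn_gt0 3 (a + b).+1; move: w_others; rewrite addSn addnS.
  rewrite [in X in X -> _]expnS; lia.
- move=> a1 b1 s1 a2 b2 s2; rewrite !inE.
  move=> /or3P[/eqP[-> -> _]|/eqP[-> -> _]|h1] /or3P[/eqP[-> -> _]|/eqP[-> -> _]|h2];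
    try by [lia | have := far _ _ _ h1; lia | have := far _ _ _ h2; lia].
  exact: st_others h1 h2.
- move=> a1 b1 s1; rewrite !inE.
  case/predU1P => [[-> -> _]|/predU1P[[-> -> _]|h]]; last exact: co_others h.
    by move=> i j ia jb; apply: (co _ _ _ abs_L) => //; apply: ltnW.
  by move=> i j ia jb; apply: (co _ _ _ abs_L) => //; apply: ltnW.
- move=> m mf a1 b1 s1; rewrite !inE.
  case/predU1P => [[-> -> ->]|/predU1P[[-> -> ->]|h]].
  + move=> h; apply: (cf _ mf _ _ _ abs_L); move: h; exact: supports_chainS.
  + move=> h; apply: (cf _ mf _ _ _ abs_L); move: h; exact: supports_chainS.
  + exact: cf_others mf _ _ _ h.
move=> Y YN.
have YO a1 b1 s1 : (a1, b1, s1) \in others -> (\rank (corner Y a1 b1) < s1)%N.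
  by move=> h; apply: YN; rewrite !inE h !orbT.
have [small|big] := ltnP (\rank (corner Y a b)) s.
  rewrite -[RHS](slice0 Y); last first.
    by move=> a1 b1 s1; rewrite inE => /predU1P[[-> -> ->]|/YO].
  congr (_.@[_]); apply/mpolyP => m; rewrite mcoeff_slice e0.
  case: eqP => // mx; apply: memN_msupp_eq0; apply/negP => /mx0; exact: mx.
have [z hz] : exists z, (\rank (corner (set_entry Y a b z) a.+1 b.+1)
             <= \rank (corner Y a b.+1))%N.
  apply: corner_completion; apply: leq_trans big; rewrite -ltnS.
  by apply: YN; rewrite !inE eqxx orbT.
rewrite -(f_free Y z); apply: f0 => a1 b1 s1 h1.
have [E|ne] := eqVneq (a1, b1) (a.+1, b.+1).
  case: E => ? ?; subst a1 b1; apply: leq_trans (bound _ h1).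
  by apply: leq_ltn_trans hz _; apply: YN; rewrite mem_head.
have h2 : (a1, b1, s1) \in others by rewrite mem_filter ne.
rewrite corner_set_entry ?YO //.
by have := far _ _ _ h2; lia.
Qed.

End Vanishing.

(** * The monomial order *)

Section MonomialOrder.
Variables d n : nat.
Implicit Types (m : cell_mon d n) (x y z : cell_var d n).

(** At equal degrees, two sorted words first differ where one of them runs out of
    the largest variable whose exponents differ. *)
Definition deglex_gt m m' : bool :=
  (mdeg m' < mdeg m)%N ||
  (mdeg m == mdeg m') &&
  [exists x, (m' (enum_rank x) < m (enum_rank x))%N &&
    [forall y, var_gt y x ==> (m (enum_rank y) == m' (enum_rank y))]].

Lemma var_gt_irr x : var_gt x x = false.
Proof. by rewrite /var_gt !ltnn andbF. Qed.

Lemma var_gt_trans : transitive (@var_gt d n).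
Proof. by move=> y x z; rewrite /var_gt -!val_eqE /=; lia. Qed.

Lemma var_gt_total x y : x != y -> var_gt x y || var_gt y x.
Proof.
case: x y => [x1 x2] [y1 y2]; rewrite xpair_eqE /var_gt -!val_eqE /=; lia.
Qed.

Lemma var_ge_trans : transitive (@var_ge d n).
Proof.
move=> y x z; rewrite /var_ge => /predU1P[->//|xy] /predU1P[<-|yz].
  by rewrite xy orbT.
by rewrite (var_gt_trans xy yz) orbT.
Qed.

Lemma var_ge_total : total (@var_ge d n).
Proof.
move=> x y; rewrite /var_ge eq_sym; case: (eqVneq y x) => //= yx.
by rewrite var_gt_total // eq_sym.
Qed.

Lemma var_gt_ge_trans x y z : var_gt x y -> var_ge y z -> var_gt x z.
Proof. by move=> xy /predU1P[<-//|]; exact: var_gt_trans. Qed.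

Lemma count_mon_word m x : count_mem x (mon_word m) = m (enum_rank x).
Proof.
rewrite /mon_word (seq.permP (permEl (perm_sort _ _))) count_flatten -map_comp.
rewrite sumnE big_map big_enum (bigD1 x) //= count_nseq /= eqxx mul1n.
by rewrite big1 ?addn0 // => y /negbTE yx; rewrite count_nseq /= yx mul0n.
Qed.

Lemma size_mon_word m : size (mon_word m) = mdeg m.
Proof.
rewrite /mon_word size_sort size_flatten /shape -map_comp sumnE big_map big_enum.
rewrite mdegE (reindex enum_rank) /=; last exact: onW_bij (@enum_rank_bij _).
by apply: eq_bigr => x _; rewrite size_nseq.
Qed.

Lemma mon_word_sorted m : sorted (@var_ge d n) (mon_word m).
Proof. exact: (sort_sorted var_ge_total). Qed.

Lemma count_sorted_tail (s t : seq (cell_var d n)) u x :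
  sorted (@var_ge d n) (s ++ u :: t) -> var_gt x u -> count_mem x (u :: t) = 0%N.
Proof.
move=> srt xu; have : sorted (@var_ge d n) (u :: t).
  by have := subseq_sorted var_ge_trans (suffix_subseq s (u :: t)) srt.
move=> /(order_path_min var_ge_trans)/allP ut.
apply/count_memPn; rewrite inE negb_or; apply/andP; split.
  by apply: contraTneq xu => ->; rewrite var_gt_irr.
apply/negP => /ut/(var_gt_ge_trans xu); by rewrite var_gt_irr.
Qed.

Lemma mon_gt_deglex m m' : mon_gt m m' -> deglex_gt m m'.
Proof.
rewrite /mon_gt !size_mon_word /deglex_gt => -[->//|[-> [s [t [t' [u [v]]]]]]].
move=> [y z uv]; rewrite eqxx; apply/orP; right; apply/existsP; exists u.
have yS := mon_word_sorted m; have zS := mon_word_sorted m'.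
rewrite y in yS; rewrite z in zS; rewrite -!count_mon_word y z !count_cat.
rewrite (count_sorted_tail zS uv) /= eqxx add1n addn0 addnS ltnS leq_addr /=.
apply/forallP => w; apply/implyP => wu; rewrite -!count_mon_word y z !count_cat.
by rewrite (count_sorted_tail yS wu) (count_sorted_tail zS (var_gt_trans wu uv)).
Qed.

Lemma deglex_gt_irr m : deglex_gt m m = false.
Proof.
rewrite /deglex_gt ltnn eqxx /=; apply/existsP => -[x].
by rewrite ltnn.
Qed.

Lemma deglex_gt_trans : transitive deglex_gt.
Proof.
move=> m2 m1 m3; rewrite /deglex_gt.
case/orP => [h12|/andP[/eqP e12 /existsP[x /andP[x12 /forallP a12]]]].
  case/orP => [h23|/andP[/eqP e23 _]]; apply/orP; left; first exact: ltn_trans h23 h12.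
  by rewrite -e23.
case/orP => [h23|/andP[/eqP e23 /existsP[y /andP[y23 /forallP a23]]]].
  by apply/orP; left; rewrite e12.
apply/orP; right; rewrite e12 e23 eqxx; apply/existsP.
have [xy|] := boolP (var_gt x y).
  exists x; have /implyP/(_ xy)/eqP <- := a23 x; rewrite x12.
  apply/forallP => z; apply/implyP => zx.
  have /implyP/(_ zx)/eqP -> := a12 z.
  by have /implyP/(_ (var_gt_trans zx xy)) := a23 z.
have [xy _|ne] := eqVneq x y.
  rewrite xy in x12 a12; exists y; rewrite (ltn_trans y23 x12).
  apply/forallP => z; apply/implyP => zy.
  have /implyP/(_ zy)/eqP -> := a12 z.
  by have /implyP/(_ zy) := a23 z.
move=> nxy; have yx : var_gt y x by have := var_gt_total ne; rewrite (negbTE nxy).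
exists y; have /implyP/(_ yx)/eqP -> := a12 y; rewrite y23.
apply/forallP => z; apply/implyP => zy.
have /implyP/(_ (var_gt_trans zy yx))/eqP -> := a12 z.
by have /implyP/(_ zy) := a23 z.
Qed.

Lemma deglex_gt_add2l k m m' : deglex_gt m m' -> deglex_gt (k + m)%MM (k + m')%MM.
Proof.
rewrite /deglex_gt !mdegD ltn_add2l eqn_add2l => /orP[->//|/andP[->]].
case/existsP => x /andP[h1 /forallP h2]; apply/orP; right; apply/existsP; exists x.
rewrite !mnmDE ltn_add2l h1; apply/forallP => y; rewrite !mnmDE eqn_add2l.
exact: h2.
Qed.

Lemma seq_first_difference (T : eqType) (s t : seq T) : size s = size t -> s != t ->
  exists (p s' t' : seq T) (u v : T), [/\ s = p ++ u :: s', t = p ++ v :: t' & u != v].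
Proof.
elim: s t => [|u s IH] [|v t] //= [/IH st]; rewrite eqseq_cons.
case: eqVneq => [<- /= /st[p [s' [t' [a [b [-> -> ab]]]]]]|uv _].
  by exists (u :: p), s', t', a, b.
by exists [::], s, t, u, v.
Qed.

(** The order of words is total and the order of exponents is irreflexive, so that
    the implication [mon_gt_deglex] can be reversed. *)
Lemma mon_gtP m m' : reflect (mon_gt m m') (deglex_gt m m').
Proof.
apply: (iffP idP); last exact: mon_gt_deglex.
move=> gt; rewrite /mon_gt !size_mon_word.
have := gt; rewrite {1}/deglex_gt => /orP[|/andP[/eqP sz _]]; [by left | right].
split=> //; have [E|ne] := eqVneq (mon_word m) (mon_word m').
  suff mm' : m = m' by rewrite mm' deglex_gt_irr in gt.
  by apply/mnmP => i; rewrite -(enum_valK i) -!count_mon_word E.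
have [|p [t [t' [u [v [y z uv]]]]]] := seq_first_difference _ ne.
  by rewrite !size_mon_word.
exists p, t, t', u, v; split=> //; have /orP[//|vu] := var_gt_total uv.
have : deglex_gt m' m.
  apply: mon_gt_deglex; right; rewrite !size_mon_word; split=> //.
  by exists p, t', t, v, u.
by move/(deglex_gt_trans gt); rewrite deglex_gt_irr.
Qed.

(** Only finitely many monomials have bounded degree. *)
Lemma deglex_ind (P : cell_mon d n -> Prop) :
  (forall m, (forall m', deglex_gt m m' -> P m') -> P m) -> forall m, P m.
Proof.
move=> step m0; have [D] := ubnP (mdeg m0).
pose below m := [set m' : bmultinom (nb_var d n) D | deglex_gt m m'].
have [k] := ubnP #|below m0|; elim: k m0 => // k IH m0 lt_k lt_D.
apply: step => m1 gt.
have lt1 : (mdeg m1 < D)%N.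
  by move: gt; rewrite /deglex_gt => /orP[/ltn_trans->//|/andP[/eqP <-]].
apply: (IH _ _ lt1); rewrite -ltnS; apply: leq_trans lt_k; rewrite ltnS.
apply: proper_card; apply/properP; split.
  by apply/subsetP => m'; rewrite !inE; exact: deglex_gt_trans.
by exists (BMultinom lt1); rewrite !inE ?deglex_gt_irr.
Qed.

End MonomialOrder.

(** * Division with remainder *)

Section GroebnerCriterion.
Variables (K : fieldType) (d n : nat).
Implicit Types (f g h : cell_ring K d n) (m : cell_mon d n).

Lemma ideal_gen_mem (A : comNzRingType) (S : A -> Prop) a x :
  S x -> ideal_gen S (a * x).
Proof.
by move=> Sx; exists [:: (a, x)]; split=> [p|]; rewrite ?big_seq1 // inE => /eqP ->.
Qed.

Lemma ideal_genD (A : comNzRingType) (S : A -> Prop) x y :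
  ideal_gen S x -> ideal_gen S y -> ideal_gen S (x + y).
Proof.
move=> [s [Ss ->]] [t [St ->]]; exists (s ++ t); rewrite big_cat; split=> // p.
by rewrite mem_cat => /orP[/Ss|/St].
Qed.

Lemma ideal_gen0 (A : comNzRingType) (S : A -> Prop) : ideal_gen S 0.
Proof. by exists [::]; rewrite big_nil. Qed.

Lemma ideal_genMl (A : comNzRingType) (S : A -> Prop) a x :
  ideal_gen S x -> ideal_gen S (a * x).
Proof.
move=> [s [Ss ->]]; exists [seq (a * p.1, p.2) | p <- s]; split.
  by move=> p /mapP[q /Ss Sq ->].
by rewrite big_map mulr_sumr; apply: eq_bigr => p _; rewrite mulrA.
Qed.

Lemma ideal_gen_sub (A : comNzRingType) (S T : A -> Prop) x :
  (forall y, S y -> ideal_gen T y) -> ideal_gen S x -> ideal_gen T x.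
Proof.
move=> ST [s [Ss ->]]; elim: s Ss => [|p s IH] Ss.
  by rewrite big_nil; apply: ideal_gen0.
rewrite big_cons; apply: ideal_genD.
  by apply/ideal_genMl/ST/Ss; rewrite mem_head.
by apply: IH => q qs; apply: Ss; rewrite inE qs orbT.
Qed.

Definition is_lead f m : bool :=
  (m \in msupp f) && all (fun m' => (m' == m) || deglex_gt m m') (msupp f).

Lemma is_leadP f m : reflect (initial_term f 'X_[m]) (is_lead f m).
Proof.
apply: (iffP andP) => [[mf /allP lead]|[m1 [/mpolyP/(_ m1) E mf lead]]].
  exists m; split=> // m' m'f ne; apply/mon_gtP.
  by have := lead _ m'f; rewrite (negbTE ne).
move: E; rewrite !mcoeffX eqxx; case: eqP => [->|_ /esym/eqP]; last by rewrite oner_eq0.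
split=> //; apply/allP => m' m'f; have [//|ne] := eqVneq m' m1.
exact/mon_gtP/lead.
Qed.

Definition reducible (G : seq (cell_ring K d n)) m : bool :=
  has (fun g => has (fun l => is_lead g l && (l <= m)%MM) (msupp g)) G.

Variable G : seq (cell_ring K d n).
Let I := ideal_gen (fun g => g \in G).

(** Division with remainder, the monomials of the remainder being restricted to B:
    taking for B those below a given monomial keeps track of initial terms without
    choosing them. *)
Definition reduces_in (B : cell_mon d n -> Prop) f : Prop :=
  exists r, I (f - r) /\ forall m, m \in msupp r -> ~~ reducible G m /\ B m.

Lemma reduces_in_sum (B : cell_mon d n -> Prop) (s : seq (cell_mon d n))
    (c : cell_mon d n -> K) :
  (forall m, m \in s -> reduces_in B 'X_[m]) ->
  reduces_in B (\sum_(m <- s) c m *: 'X_[m]).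
Proof.
elim: s => [|m s IH] sB.
  exists 0; rewrite big_nil subr0; split; first exact: ideal_gen0.
  by move=> m; rewrite msupp0.
have [r [Ir rB]] : reduces_in B 'X_[m] by apply: sB; rewrite mem_head.
have [r' [Ir' rB']] : reduces_in B (\sum_(m' <- s) c m' *: 'X_[m']).
  by apply: IH => m' m's; apply: sB; rewrite inE m's orbT.
exists (c m *: r + r'); split.
  rewrite big_cons opprD addrACA; apply: ideal_genD => //.
  by rewrite -scalerBr -mul_mpolyC; apply: ideal_genMl.
move=> m' /msuppD_le; rewrite mem_cat => /orP[/msuppZ_le/rB|/rB'] //.
Qed.

(** If an initial term divides the monomial m, subtract a multiple of the element of
    G so that m cancels, and divide the smaller monomials that remain. *)
Lemma monomial_reduces m : reduces_in (fun m' => (m' == m) || deglex_gt m m') 'X_[m].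
Proof.
elim/deglex_ind: m => m IH; have [red|irr] := boolP (reducible G m); last first.
  exists 'X_[m]; rewrite subrr; split; first exact: ideal_gen0.
  by move=> m'; rewrite msuppX inE => /eqP ->; rewrite eqxx.
have /hasP[g gG /hasP[l lg /andP[/andP[_ /allP lead] lm]]] := red.
pose k := (m - l)%MM; pose q := (g@_l)^-1 *: (g * 'X_[k]).
have km : (k + l)%MM = m by rewrite submK.
have gl0 : g@_l != 0 by rewrite -mcoeff_msupp.
have Iq : I q by rewrite /q -mul_mpolyC mulrA mulrAC; apply: ideal_gen_mem.
have lower m' : m' \in msupp ('X_[m] - q) -> deglex_gt m m'.
  have [->|ne] := eqVneq m' m.
    rewrite mcoeff_msupp mcoeffB mcoeffX eqxx mcoeffZ -{1}km mcoeffMX.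
    by rewrite mulVf // subrr eqxx.
  move/msuppB_le; rewrite mem_cat msuppX inE (negbTE ne) => /msuppZ_le.
  rewrite (perm_mem (msuppMX _ _)) => /mapP[m1 m1g m'E].
  rewrite -km m'E; apply: deglex_gt_add2l.
  have := lead _ m1g; case: eqP => // m1l.
  by rewrite m'E m1l km eqxx in ne.
have [r [Ir rP]] : reduces_in (fun m' => deglex_gt m m') ('X_[m] - q).
  rewrite [X in reduces_in _ X]mpolyE; apply: reduces_in_sum => m' /lower mm'.
  have [r [Ir rP]] := IH _ mm'; exists r; split=> // m1 /rP[-> /predU1P[->//|]].
  by split=> //; exact: deglex_gt_trans mm' _.
exists r; split; last by move=> m' /rP[-> ->]; rewrite orbT.
by rewrite -(subrK q 'X_[m]) addrAC; apply: ideal_genD.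
Qed.

(** If the initial term m of some h in I were not reducible, dividing all other
    monomials of h would give an element of I with irreducible monomials only, in
    which m still has the coefficient that it has in h. *)
Theorem groebner_basis_standard_independent :
  (forall f, I f -> (forall m, m \in msupp f -> ~~ reducible G m) -> f = 0) ->
  groebner_basis G I.
Proof.
move=> indep; split=> [g gG|f].
  by rewrite -[g]mul1r; apply: ideal_gen_mem.
split; apply: ideal_gen_sub => t [h [hI ht]]; last first.
  rewrite -[t]mul1r; apply: ideal_gen_mem; exists h; split=> //.
  by rewrite -[h]mul1r; apply: ideal_gen_mem.
have [m [tE mh lead]] := ht.
have [/hasP[g gG /hasP[l lg /andP[gl lm]]]|irr] := boolP (reducible G m).
  rewrite tE -(submK lm) mpolyXD; apply: ideal_gen_mem; exists g.
  by split=> //; apply/is_leadP.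
pose c m' := h@_m'.
have hE : h = c m *: 'X_[m] + \sum_(m' <- rem m (msupp h)) c m' *: 'X_[m'].
  by rewrite {1}[h]mpolyE (big_rem _ mh).
have [r [Ir rP]] : reduces_in (fun m' => deglex_gt m m')
    (\sum_(m' <- rem m (msupp h)) c m' *: 'X_[m']).
  apply: reduces_in_sum => m'; rewrite mem_rem_uniq ?msupp_uniq // inE.
  case/andP=> ne m'h; have mm' : deglex_gt m m' by apply/mon_gtP/lead.
  have [r [Ir rP]] := monomial_reduces m'; exists r; split=> // m1.
  by move=> /rP[-> /predU1P[->//|]]; split=> //; exact: deglex_gt_trans mm' _.
(* The remainder has monomials below m only, so m cannot cancel. *)
have F0 : c m *: 'X_[m] + r = 0.
  apply: indep.
    have -> : c m *: 'X_[m] + r = h + (- 1) *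
        (\sum_(m' <- rem m (msupp h)) c m' *: 'X_[m'] - r).
      by rewrite {1}hE; ring.
    by apply: ideal_genD => //; apply: ideal_genMl.
  move=> m' /msuppD_le; rewrite mem_cat => /orP[/msuppZ_le|/rP[]//].
  by rewrite msuppX inE => /eqP ->.
have := congr1 (mcoeff m) F0; rewrite mcoeffD mcoeffZ mcoeffX eqxx mulr1 mcoeff0.
rewrite (memN_msupp_eq0 (p := r)) ?addr0; last first.
  by apply/negP => /rP[_]; rewrite deglex_gt_irr.
by move/eqP; rewrite mcoeff_eq0 mh.
Qed.

End GroebnerCriterion.

(** * Initial terms of Pluecker coordinates *)

Section PlueckerLead.
Variables (K : fieldType) (d n : nat).
Implicit Types (theta w : Idn d n) (s : {perm 'I_d}).

Lemma Idn_ltn theta (i j : 'I_d) :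
  (i < j)%N -> (tnth (val theta) i < tnth (val theta) j)%N.
Proof.
case: theta => t /= t_srt ij; have lt k : (k < d)%N -> (k < size t)%N by rewrite size_tuple.
have x0 : 'I_n := tnth t i; rewrite !(tnth_nth x0) -!(nth_map x0 0%N val) ?lt //.
by apply: (sorted_ltn_nth ltn_trans) => //; rewrite inE size_map lt.
Qed.

Lemma Idn_inj theta : injective (tnth (val theta)).
Proof.
move=> i j E; apply/val_inj/eqP; rewrite eqn_leq; apply/andP.
by split; rewrite leqNgt; apply/negP => /(Idn_ltn theta); rewrite E ltnn.
Qed.

(** The monomial of the Leibniz term of s: rows with index less than d belong to
    the identity block and contribute no variable. *)
Definition perm_mon theta s : cell_mon d n :=
  (\sum_(i < d) if insub (tnth (val theta) i) is Some r
                then U_(enum_rank ((r, s i) : cell_var d n)) else 0)%MM.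

(** The Leibniz term of s does not vanish on the identity block. *)
Definition perm_compat theta s : bool :=
  [forall i : 'I_d, (tnth (val theta) i < d)%N ==> (tnth (val theta) i == s i :> nat)].

Lemma pluecker_sum theta : pluecker K theta =
  \sum_(s | perm_compat theta s) (-1) ^+ s *: 'X_[perm_mon theta s].
Proof.
rewrite /pluecker /determinant [RHS]big_mkcond; apply: eq_bigr => s _.
rewrite /perm_mon; case: ifPn => [/forallP comp|].
  rewrite -mul_mpolyC rmorphXn /= rmorphN1; congr (_ * _).
  rewrite (big_morph (fun m => 'X_[m]) (@mpolyXD _ _) (@mpolyX0 _ _)).
  apply: eq_bigr => i _; rewrite !mxE.
  case: insubP => [//|]; rewrite -ltnNge => di.
  by have := comp i; rewrite di /= => ->; rewrite mpolyX0.
rewrite negb_forall => /existsP[i]; rewrite negb_imply => /andP[id ne].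
rewrite (bigD1 i) //= !mxE; case: insubP => [r|_]; first by rewrite leqNgt id.
by rewrite (negbTE ne) mul0r mulr0.
Qed.

Lemma perm_monE theta s (y : cell_var d n) :
  perm_mon theta s (enum_rank y) =
  (\sum_(i < d) ((tnth (val theta) i == val y.1) && (s i == y.2)))%N.
Proof.
rewrite /perm_mon mnm_sumE; apply: eq_bigr => i _; case: y => y1 y2 /=.
case: insubP => [r _ rE|lt].
  by rewrite mnm1E (inj_eq enum_rank_inj) xpair_eqE -rE (inj_eq val_inj).
rewrite mnm0E; case: eqP => // E; case/negP: lt; rewrite E; exact: (valP y1).
Qed.

Lemma mdeg_perm_mon theta s :
  mdeg (perm_mon theta s) = (\sum_(i < d) (d <= tnth (val theta) i))%N.
Proof.
rewrite /perm_mon mdeg_sum; apply: eq_bigr => i _.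
by case: insubP => [r -> _|/negbTE ->]; rewrite ?mdeg1 ?mdeg0.
Qed.

(** Together with [perm_compat], this says that s picks for each row of X the
    leftmost column that the rows below it have left free: the antidiagonal of the
    minor of X. *)
Definition antitone_perm theta s : Prop :=
  forall i j : 'I_d, (i < j)%N -> (d <= tnth (val theta) i)%N -> (s j < s i)%N.

(** Let i be the lowest row where t and s differ.  The rows below i use the same
    columns, so t i is a column that s uses in a higher row of X, hence it lies to
    the right of s i; the variable in row theta_i and column s i decides. *)
Lemma antitone_perm_lead theta s t :
  perm_compat theta s -> antitone_perm theta s -> perm_compat theta t -> t != s ->
  deglex_gt (perm_mon theta s) (perm_mon theta t).
Proof.
move=> /forallP cs anti /forallP ct ts.
have [i0 i0P] : exists i, t i != s i.
  by apply/existsP; apply: contraNT ts; rewrite negb_exists => /forallP h;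
     apply/eqP/permP => i; apply/eqP; rewrite -[_ == _]negbK.
case: (@arg_maxnP _ i0 (fun i => t i != s i) (fun i => i : nat) i0P) => i ne max_i.
have agree (j : 'I_d) : (i < j)%N -> t j = s j.
  by rewrite ltnNge => h; apply/eqP; apply: contraNT h => /max_i.
have big_row j : t j != s j -> (d <= tnth (val theta) j)%N.
  move=> nej; rewrite leqNgt; apply: contraNN nej => lt.
  have := cs j; have := ct j; rewrite lt /= => /eqP e1 /eqP e2.
  by rewrite -val_eqE /= -e1 e2.
pose j := (s^-1)%g (t i); have sj : s j = t i by rewrite permKV.
have ji : (j < i)%N.
  rewrite ltn_neqAle; apply/andP; split.
    by apply: contraNneq ne => /val_inj E; rewrite -sj E.
  rewrite leqNgt; apply/negP => lt; have := agree j lt.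
  by rewrite sj => /perm_inj E; rewrite E ltnn in lt.
have dj : (d <= tnth (val theta) j)%N.
  apply: big_row; rewrite sj (inj_eq perm_inj).
  by apply/eqP => E; rewrite E ltnn in ji.
have lt_col : (s i < t i)%N by rewrite -sj; apply: anti.
rewrite /deglex_gt !mdeg_perm_mon eqxx; apply/orP; right; apply/existsP.
have di := big_row i ne.
exists (exist (fun r : 'I_n => d <= r)%N _ di, s i); apply/andP; split.
  rewrite !perm_monE big1 /= => [|k _].
    by rewrite (bigD1 i) //= !eqxx.
  case: eqP => //= /Idn_inj ->; case: eqP => // E; by rewrite E eqxx in ne.
apply/forallP => y; apply/implyP; rewrite /var_gt /= -val_eqE /= => gt.
rewrite !perm_monE; apply/eqP; apply: eq_bigr => k _.
case: eqP => //= kE; rewrite -kE in gt.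
have [ik|ik] := ltnP i k; first by rewrite agree.
have [ki|E] : (k < i)%N \/ k = i.
  by move: ik; rewrite leq_eqVlt => /predU1P[/val_inj ->|]; [right|left].
  by have := Idn_ltn theta ki; move: gt; rewrite -val_eqE /=; lia.
subst k; move: gt; rewrite ltnn /= => /andP[_ lt].
by rewrite -[s i == _]val_eqE -[t i == _]val_eqE /= !gtn_eqF // (ltn_trans lt).
Qed.

Lemma antitone_perm_is_lead theta s :
  perm_compat theta s -> antitone_perm theta s ->
  is_lead (pluecker K theta) (perm_mon theta s).
Proof.
move=> cs anti; rewrite /is_lead pluecker_sum; apply/andP; split.
  rewrite mcoeff_msupp raddf_sum (bigD1 s) //= mcoeffZ mcoeffX eqxx mulr1.
  rewrite big1 ?addr0 ?signr_eq0 // => t /andP[ct ts].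
  rewrite mcoeffZ mcoeffX; case: eqP => [E|]; rewrite ?mulr0 //.
  by have := antitone_perm_lead cs anti ct ts; rewrite E deglex_gt_irr.
apply/allP => m; rewrite mcoeff_msupp raddf_sum => h.
have [t /andP[ct]] : exists t, perm_compat theta t && (m == perm_mon theta t).
  apply/existsP; apply: contraNT h => /existsPn h; rewrite big1 // => t ct.
  by have := h t; rewrite ct /= mcoeffZ mcoeffX eq_sym => /negbTE ->; rewrite mulr0.
move/eqP->; have [->|ts] := eqVneq t s; first by rewrite eqxx.
by rewrite antitone_perm_lead ?orbT.
Qed.

End PlueckerLead.

(** * The rank conditions of a Schubert variety *)

Section SchubertConditions.
Variables (K : fieldType) (d n : nat).
Implicit Types (theta w : Idn d n) (c : seq (cell_var d n)).

(** Rows are counted from the last one, which turns antidiagonals into diagonals. *)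
Definition flip_pos (k : 'I_(nb_var d n)) : nat * nat :=
  let x := enum_val k in ((n.-1 - val (val x.1))%N, val x.2).

Lemma flip_pos_inj : injective flip_pos.
Proof.
move=> k l [] h1 /val_inj h2; apply: enum_val_inj.
move: (enum_val k) (enum_val l) h1 h2 => [x1 x2] [y1 y2] /= h1 ->; congr (_, _).
apply/val_inj/val_inj => /=; have := ltn_ord (val x1); have := ltn_ord (val y1).
by rewrite /=; lia.
Qed.

(** If theta_t > w_t, the last d - t rows of theta lie after w_t, so f_theta vanishes
    where the rows after w_t of the full n x d matrix have rank less than d - t.
    Removing the rows of the identity block among them, together with their
    columns, leaves a corner of X with these numbers of rows and columns. *)
Definition schubert_rows w (t : 'I_d) : nat := (n - maxn (tnth (val w) t).+1 d)%N.
Definition schubert_cols w (t : 'I_d) : nat := minn (tnth (val w) t).+1 d.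

Definition schubert_conditions w : seq (nat * nat * nat) :=
  [seq (schubert_rows w t, schubert_cols w t, schubert_cols w t - t)%N
     | t : 'I_d].

Lemma schubert_staircase w : staircase (schubert_conditions w).
Proof.
move=> a b s a1 b1 s1 /mapP[t _ [-> -> _]] /mapP[t1 _ [-> -> _]].
rewrite /schubert_rows /schubert_cols.
have [/(Idn_ltn w)|/(Idn_ltn w)|/val_inj ->] := ltngtP t t1; lia.
Qed.

Lemma schubert_covered w : covered flip_pos (schubert_conditions w).
Proof.
move=> a b s /mapP[t _ [-> -> _]] i j; rewrite /schubert_rows /schubert_cols.
move=> ia jb; have jd : (j < d)%N by lia.
have rn : (n.-1 - i < n)%N by lia.
have dr : (d <= Ordinal rn)%N by rewrite /=; lia.
exists (enum_rank ((exist (fun r : 'I_n => d <= r)%N _ dr, Ordinal jd) : cell_var d n)).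
by rewrite /flip_pos enum_rankK /=; congr (_, _); lia.
Qed.

Definition cell_anti (x y : cell_var d n) : bool :=
  (val (val y.1) < val (val x.1))%N && (x.2 < y.2)%N.

Lemma cell_anti_trans : transitive cell_anti.
Proof. by move=> y x z; rewrite /cell_anti; lia. Qed.

Section FromChain.
Variable c : seq (cell_var d n).
Hypothesis c_anti : sorted cell_anti c.

(** Consecutive cells are comparable and the relation is transitive. *)
Lemma chain_comparable x y : x \in c -> y \in c ->
  [|| x == y, cell_anti x y | cell_anti y x].
Proof.
elim: c c_anti => // z s IH /= zs; have := order_path_min cell_anti_trans zs.
move=> /allP zP; have {}IH := IH (path_sorted zs); rewrite !inE.
case/predU1P => [->|xs]; case/predU1P => [->|ys]; last exact: IH.
- by rewrite eqxx.
- by rewrite (zP _ ys) orbT.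
- by rewrite (zP _ xs) !orbT.
Qed.

Hypothesis dn : (d <= n)%N.

(** The rows of the minor belonging to the chain: the identity row j, replaced by
    the row of the cell of the chain in column j if there is one. *)
Definition chain_row (j : 'I_d) : 'I_n :=
  if [pick x in c | x.2 == j] is Some x then val x.1 else widen_ord dn j.

Variant chain_row_spec (j : 'I_d) : 'I_n -> Prop :=
| ChainRowIn x of x \in c & x.2 = j : chain_row_spec j (val x.1)
| ChainRowOut of (forall x, x \in c -> x.2 != j) : chain_row_spec j (widen_ord dn j).

Lemma chain_rowP j : chain_row_spec j (chain_row j).
Proof.
rewrite /chain_row; case: pickP => [x /andP[xc /eqP E]|h]; first exact: ChainRowIn.
by apply: ChainRowOut => x xc; have := h x; rewrite xc /= => ->.
Qed.

Lemma chain_row_inj : injective chain_row.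
Proof.
move=> j k; case: chain_rowP => [x xc <-|hj]; case: chain_rowP => [y yc <-|hk] E.
- have := chain_comparable xc yc; rewrite /cell_anti E ltnn !orbF.
  by move=> /eqP ->.
- have := valP x.1; have := ltn_ord k; rewrite E /=; lia.
- have := valP y.1; have := ltn_ord j; rewrite -E /=; lia.
- by apply: val_inj; exact: (congr1 val E).
Qed.

(** Sorting the rows [chain_row j] gives theta; s remembers the columns. *)
Lemma chain_theta : exists (theta : Idn d n) (s : {perm 'I_d}),
  forall i, tnth (val theta) i = chain_row (s i).
Proof.
pose A := [set chain_row j | j : 'I_d].
have szA : size (enum A) == d.
  by rewrite -cardE card_imset ?card_ord //; exact: chain_row_inj.
have srtA : sorted ltn [seq val i | i <- Tuple szA].
  rewrite /= sorted_map; apply: sorted_filter; first by move=> ? ? ?; exact: ltn_trans.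
  by rewrite -sorted_map -enumT val_enum_ord iota_ltn_sorted.
pose theta : Idn d n :=
  exist (fun t : d.-tuple 'I_n => sorted ltn [seq val i | i <- t]) _ srtA.
have thP i : exists j, tnth (val theta) i == chain_row j.
  have : tnth (val theta) i \in A by rewrite -mem_enum; exact: (mem_tnth i (Tuple szA)).
  by case/imsetP => j _ ->; exists j.
have s_inj : injective (fun i => xchoose (thP i)).
  move=> i j E; apply: (@Idn_inj d n theta).
  by rewrite (eqP (xchooseP (thP i))) E -(eqP (xchooseP (thP j))).
by exists theta, (perm s_inj) => i; rewrite permE; exact: (eqP (xchooseP (thP i))).
Qed.

Variables (theta : Idn d n) (s : {perm 'I_d}).
Hypothesis theta_s : forall i, tnth (val theta) i = chain_row (s i).

Lemma chain_perm_compat : perm_compat theta s.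
Proof.
apply/forallP => i; apply/implyP; rewrite theta_s; case: chain_rowP => // x _ _.
by rewrite ltnNge (valP x.1).
Qed.

Lemma chain_perm_antitone : antitone_perm theta s.
Proof.
move=> i j /(Idn_ltn theta); rewrite !theta_s.
case: (chain_rowP (s i)) => [x xc <-|_ _]; last by rewrite /= leqNgt ltn_ord.
move=> lt dx; move: lt; case: chain_rowP => [y yc <- lt|_ lt]; last first.
  by have := ltn_ord (s j); move: lt dx; rewrite /=; lia.
case/or3P: (chain_comparable xc yc) => [/eqP E|/andP[gt]|/andP[]//].
  by rewrite E ltnn in lt.
by rewrite ltnNge (ltnW gt) in lt.
Qed.

Lemma chain_perm_mon_le (m : cell_mon d n) :
  (forall x, x \in c -> 0 < m (enum_rank x))%N -> (perm_mon theta s <= m)%MM.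
Proof.
move=> mc; apply/mnm_lepP => k; rewrite -(enum_valK k) perm_monE.
move: (enum_val k) => x; have [xc|xc] := boolP (x \in c).
  apply: leq_trans (mc x xc).
  pose i := (s^-1)%g x.2; rewrite (bigD1 i) //= big1 ?addn0 ?leq_b1 // => j ji.
  apply/eqP; rewrite eqb0 negb_and; apply/orP; right.
  by apply: contraNneq ji => E; rewrite /i -E permK.
rewrite big1 // => i _; apply/eqP; rewrite eqb0 theta_s; apply: contra xc.
case/andP; case: chain_rowP => [y yc <-|_].
  move=> /eqP/val_inj E1 /eqP E2; suff -> : x = y by [].
  by case: x y {yc} E1 E2 => [x1 x2] [y1 y2] /= -> ->.
by move=> /eqP/(congr1 val)/= E; have := valP x.1; rewrite /= -E leqNgt ltn_ord.
Qed.

(** If theta_t <= w_t, the t + 1 columns of the rows up to theta_t are disjoint from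
    those of the chain, since the rows of the chain lie after w_t.  Together these
    are more columns than the corner has. *)
Lemma chain_not_bruhat_le w (t : 'I_d) :
  (size c = schubert_cols w t - t)%N ->
  all (fun x : cell_var d n => (tnth (val w) t < val (val x.1))%N &&
         (x.2 < schubert_cols w t)%N) c ->
  ~~ bruhat_le theta w.
Proof.
move=> sz /allP cP; apply/negP => /forallP/(_ t) le_t.
have low (i : 'I_d) : (i <= t)%N ->
    (s i < schubert_cols w t)%N /\ forall x, x \in c -> x.2 != s i.
  move=> it; have : (tnth (val theta) i <= tnth (val w) t)%N.
    apply: leq_trans le_t; move: it; rewrite leq_eqVlt => /predU1P[/val_inj -> //|].
    by move/(Idn_ltn theta)/ltnW.
  rewrite theta_s; case: chain_rowP => [x xc _|h].
    by rewrite leqNgt; have /andP[-> _] := cP _ xc.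
  by rewrite /schubert_cols /= => le; split=> //; have := ltn_ord (s i); lia.
pose below := [seq i : 'I_d <- enum 'I_d | (i <= t)%N].
pose l := [seq (s i : nat) | i <- below] ++ [seq (x.2 : nat) | x : cell_var d n <- c].
have ul : uniq l.
  rewrite cat_uniq; apply/and3P; split.
  - rewrite map_inj_uniq; first by apply/filter_uniq/enum_uniq.
    by move=> i j /val_inj/perm_inj.
  - apply/hasPn => _ /mapP[x xc ->]; apply/negP => /mapP[i].
    rewrite mem_filter => /andP[/low[_ /(_ x xc) ne] _] /val_inj E.
    by rewrite E eqxx in ne.
  - rewrite map_inj_in_uniq.
      have: irreflexive cell_anti by move=> x; rewrite /cell_anti ltnn.
      by move=> irr; apply: (sorted_uniq cell_anti_trans irr).
    move=> x y xc yc /val_inj E; have := chain_comparable xc yc.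
    by rewrite /cell_anti E ltnn !andbF !orbF => /eqP.
have sub : {subset l <= iota 0 (schubert_cols w t)}.
  move=> k; rewrite mem_cat mem_iota /= add0n => /orP[] /mapP[].
    by move=> i; rewrite mem_filter => /andP[/low[h _] _] ->.
  by move=> x /cP/andP[_ h] ->.
have := uniq_leq_size ul sub; rewrite size_iota size_cat !size_map sz.
have -> : size below = t.+1.
  rewrite -(size_map val) -[X in map _ X](@eq_filter _ (preim val (fun i => i <= t)%N)) //.
  rewrite -filter_map val_enum_ord.
  have -> : iota 0 d = iota 0 t.+1 ++ iota t.+1 (d - t.+1).
    by rewrite -iotaD subnKC.
  rewrite filter_cat size_cat [X in (_ + size X)%N](_ : _ = [::]) ?addn0.
    rewrite (_ : filter _ _ = iota 0 t.+1) ?size_iota //.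
    by apply/all_filterP/allP => k; rewrite mem_iota /= add0n ltnS.
  apply/eqP; rewrite -[_ == _]negbK -has_filter; apply/negP => /hasP[k].
  by rewrite mem_iota; lia.
by lia.
Qed.

End FromChain.

End SchubertConditions.

Section Vanish.
Variables (K : fieldType) (d n : nat).
Implicit Types (theta w : Idn d n).

(** If the determinant were not 0, the rows from t on would be independent, of rank
    d - t.  But their part in the first b columns consists of zero rows and of rows
    of the corner, and the other d - b columns add at most d - b to the rank. *)
Lemma pluecker_vanishes w theta (Y : nat -> nat -> K) :
  rank_locus (schubert_conditions w) Y -> ~~ bruhat_le theta w ->
  (pluecker K theta).@[cell_values (@flip_pos d n) Y] = 0.
Proof.
move=> YL; rewrite negb_forall => /existsP[t]; rewrite -ltnNge => w_lt.
pose th i := tnth (val theta) i.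
rewrite /pluecker -det_map_mx; set B := map_mx _ _.
have BE i j : B i j = if (th i < d)%N then (th i == j :> nat)%:R
                      else Y (n.-1 - th i)%N j.
  rewrite !mxE /th; case: insubP => [r dr rE|]; last first.
    by rewrite -ltnNge => ->; rewrite rmorph_nat.
  by rewrite ltnNge dr /= mevalXU /cell_values /flip_pos enum_rankK /= rE.
set a := schubert_rows w t; set b := schubert_cols w t.
have rank_ab : (\rank (corner Y a b) < b - t)%N.
  by apply: YL; apply/mapP; exists t; rewrite ?mem_enum.
apply/eqP; apply: contraTT rank_ab => detB; rewrite -leqNgt.
have Bfree : row_free B by rewrite row_free_unit unitmxE unitfE.
have td : (t <= d)%N := ltnW (ltn_ord t).
have bd : (b <= d)%N by exact: geq_minr.
have rank_low : \rank (copid_mx t *m B) = (d - t)%N.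
  by rewrite mxrankMfree ?rank_copid_mx.
have copid_row i j : (copid_mx t *m B) i j = if (i < t)%N then 0 else B i j.
  rewrite mulmxBl mul1mx mxE [X in _ + X]mxE [X in _ - X]mxE (bigD1 i) //= !mxE eqxx big1.
    by case: ifP => _; rewrite ?mul1r ?mul0r addr0 ?subrr ?subr0.
  by move=> k ki; rewrite mxE eq_sym (negbTE (ki : (k : nat) != i)) mul0r.
have left_sub : (copid_mx t *m B *m (pid_mx b : 'M_d)
                  <= corner Y a b *m (pid_mx b : 'M_(b, d)))%MS.
  have pidE p (A : 'M[K]_(p, d)) i j :
      (A *m (pid_mx b : 'M_d)) i j = if (j < b)%N then A i j else 0.
    rewrite mxE (bigD1 j) //= mxE eqxx big1 ?addr0 => [|k kj].
      by case: ifP => _; rewrite ?mulr1 ?mulr0.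
    by rewrite mxE (negbTE (kj : (k : nat) != j)) mulr0.
  apply/row_subP => i; have [it|ti] := ltnP i t.
    rewrite (_ : row _ _ = 0) ?sub0mx //; apply/rowP => j.
    by rewrite mxE pidE copid_row it if_same mxE.
  have row_gt : (tnth (val w) t < th i)%N.
    apply: leq_trans w_lt _; move: ti; rewrite leq_eqVlt => /predU1P[/val_inj -> //|].
    by move/(Idn_ltn theta)/ltnW.
  have [lt_d|ge_d] := ltnP (th i) d.
    rewrite (_ : row _ _ = 0) ?sub0mx //; apply/rowP => j.
    rewrite mxE pidE copid_row (ltnNge i t) ti /= BE lt_d mxE; case: ifP => // jb.
    by case: eqP => // E; move: jb; rewrite /b /schubert_cols -E; lia.
  have ra : (n.-1 - th i < a)%N.
    by have := ltn_ord (th i); rewrite /a /schubert_rows; lia.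
  apply: (eq_row_sub (Ordinal ra)); apply/rowP => j.
  rewrite [LHS]mxE [RHS]mxE pidE copid_row (ltnNge i t) ti /=.
  rewrite BE (ltnNge (th i) d) ge_d /= [LHS]mxE.
  have [jb|jb] := ltnP j b.
    rewrite (bigD1 (Ordinal jb)) //= !mxE eqxx jb mulr1 big1 ?addr0 // => k kj.
    by rewrite !mxE (negbTE (kj : (k : nat) != j)) mulr0.
  rewrite big1 // => k _; rewrite !mxE; case: eqP => [E|]; rewrite ?mulr0 //.
  by have := ltn_ord k; rewrite E ltnNge jb.
have split_cols : copid_mx t *m B =
    copid_mx t *m B *m (pid_mx b : 'M_d) + copid_mx t *m B *m copid_mx b.
  by rewrite -mulmxDr addrC subrK mulmx1.
have := mxrank_add (copid_mx t *m B *m (pid_mx b : 'M_d)) (copid_mx t *m B *m copid_mx b).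
rewrite -split_cols rank_low.
have := mxrankS left_sub; have := mxrankM_maxl (corner Y a b) (pid_mx b : 'M_(b, d)).
have := mxrankM_maxr (copid_mx t *m B) (copid_mx b : 'M_d).
rewrite rank_copid_mx // => h1 h2 h3 h4.
have := leq_trans h4 (leq_add (leq_trans h3 h2) h1).
by move: (\rank (corner Y a b)) bd td; clearbody b; clear; lia.
Qed.

(** The minor of X on the rows and columns of the chain has the chain as its
    antidiagonal, and up to sign it is a Pluecker coordinate. *)
Lemma chain_reducible (w : Idn d n) (dn : (d <= n)%N) (m : cell_mon d n) a b s :
  (a, b, s) \in schubert_conditions w -> supports_chain (@flip_pos d n) m a b s ->
  reducible [seq pluecker K theta | theta <- enum {: Idn d n} & ~~ bruhat_le theta w] m.
Proof.
move=> /mapP[t _ [-> -> ->]] [c [sz srt /allP inc /allP pos]].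
have c_anti : sorted (@cell_anti d n) [seq enum_val k | k <- c].
  rewrite sorted_map; move: srt; rewrite sorted_map; apply: sub_sorted => k l.
  by rewrite /= /cell_lt /flip_pos /cell_anti /= => /andP[h ->]; rewrite andbT; lia.
have [theta [p thP]] := chain_theta c_anti dn.
apply/hasP; exists (pluecker K theta).
  apply: map_f; rewrite mem_filter mem_enum andbT.
  apply: (chain_not_bruhat_le c_anti thP (t := t)); first by rewrite size_map.
  apply/allP => _ /mapP[k /inc /andP[h1 h2] ->].
  move: h1 h2; rewrite /flip_pos /schubert_rows /= => h1 ->; rewrite andbT.
  by have := ltn_ord (val (enum_val k).1); lia.
have lead := antitone_perm_is_lead K (chain_perm_compat thP) (chain_perm_antitone c_anti thP).
apply/hasP; exists (perm_mon theta p); first by have /andP[] := lead.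
rewrite lead; apply: (chain_perm_mon_le thP) => _ /mapP[k /pos h ->].
by rewrite enum_valK.
Qed.

End Vanish.

(** * The Groebner basis *)

Theorem corollary1 (K : closedFieldType) (d n : nat) (hd : (1 <= d)%N)
  (hdn : (d < n)%N) (w : Idn d n) :
  let G := [seq pluecker K theta | theta <- enum {: Idn d n} & ~~ bruhat_le theta w] in
  groebner_basis G (ideal_gen (fun g => g \in G)).
Proof.
move=> G; apply: groebner_basis_standard_independent => f fI irr.
have K_infinite (p : {poly K}) : p != 0 -> exists x, ~~ root p x.
  by move/closed_nonrootP.
apply: (chain_free_vanishing_eq0 (@flip_pos_inj d n) K_infinite (@schubert_staircase d n w)).
- exact: schubert_covered.
- move=> m /irr/negP red a b l abl h; apply: red.
  exact: (@chain_reducible K d n w (ltnW hdn) m a b l abl h).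
have [s [sG ->]] := fI.
move=> Y YL; rewrite raddf_sum /= big1_seq // => p /andP[_ /sG].
case/mapP => theta; rewrite mem_filter => /andP[nle _] pE.
by rewrite mevalM pE (pluecker_vanishes YL nle) mulr0.
Qed.
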